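(* Let $n\in\mathbb N$, $n\ge 1$. For any $X_1,\dots,X_n\in\mathcal{B}_A(\mathcal{H})$, $$\Big\|\sum_{k=1}^{n} X_k\Big\|_A^2\leq \Big\|\sum_{k=1}^{n}X_k^{\sharp_A}X_k\Big\|_A+\frac{1}{2}\Big\|(n-2)\sum_{k=1}^{n}X_k^{\sharp_A}X_k+\Big(\sum_{k=1}^{n}X_k^{\sharp_A}\Big)\Big(\sum_{k=1}^{n}X_k\Big)\Big\|_A .$$
   Context: $(\mathcal{H},\langle\cdot,\cdot\rangle)$ is a complex Hilbert space, $\mathcal{B}(\mathcal{H})$ is the algebra of bounded linear operators on $\mathcal{H}$, and $A\in\mathcal{B}(\mathcal{H})$ is a fixed positive operator ($\langle Ax,x\rangle\ge 0$ for all $x$). Put $\langle x,y\rangle_A=\langle Ax,y\rangle$ and $\|x\|_A=\sqrt{\langle x,x\rangle_A}$ (a seminorm). $\mathcal{B}_A(\mathcal{H})=\{T\in\mathcal{B}(\mathcal{H}): \mathrm{ran}(T^*A)\subseteq \mathrm{ran}(A)\}$, equivalently the set of $T$ for which some $S\in\mathcal{B}(\mathcal{H})$ satisfies $AS=T^*A$. For $T\in\mathcal{B}_A(\mathcal{H})$, $T^{\sharp_A}$ is the reduced solution of $AX=T^*A$, i.e. the unique $X\in\mathcal{B}(\mathcal{H})$ with $AX=T^*A$ and $\mathrm{ran}(X)\subseteq\overline{\mathrm{ran}(A)}$ (equivalently $T^{\sharp_A}=A^{\dagger}T^*A$, with $A^\dagger$ the Moore–Penrose inverse). The $A$-operator seminorm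 is $\|T\|_A=\sup\{\|Tx\|_A: x\in\mathcal{H},\ \|x\|_A=1\}$. *)

(* Defs.v *)
From HB Require Import structures.
From mathcomp Require Import all_boot all_order all_algebra complex.
From mathcomp Require Import all_classical all_reals all_analysis.

Set Implicit Arguments.
Unset Strict Implicit.
Unset Printing Implicit Defensive.

Import Order.TTheory GRing.Theory Num.Theory.
Import numFieldNormedType.Exports.

Local Open Scope classical_set_scope.
Local Open Scope complex_scope.
Local Open Scope ring_scope.

(* [idot] is linear in its first argument, conjugate linear in the second. *)
HB.mixin Record CompleteNormedModule_isHilbert (R : realType) (H : Type)
    of CompleteNormedModule R[i] H := {
  idot : {dot H for (@Num.conj R[i])} ;
  idot_norm : forall x : H, idot x x = `|x| ^+ 2
}.

#[short(type="hilbertType")]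
HB.structure Definition Hilbert (R : realType) :=
  {H of CompleteNormedModule R[i] H & CompleteNormedModule_isHilbert R H}.

Section Operators.
Context {R : realType} {H : hilbertType R}.
Implicit Types (A T S X : H -> H) (x y : H).

(* B(H); sums, scalings and 0 are those of the function space H -> H. *)
Definition bounded_op : set (H -> H) :=
  [set T | linear T /\ exists M : R, forall x, `|T x| <= M%:C * `|x|].

Definition positive_op : set (H -> H) :=
  [set A | bounded_op A /\ forall x, 0 <= idot (A x) x].

Definition is_adjoint T S :=
  bounded_op S /\ forall x y, idot (T x) y = idot x (S y).

(* For bounded T there is exactly one S with is_adjoint T S; the default value
   0 is only reached for operators that are not bounded. *)
Definition adjoint T : H -> H := xget 0 [set S | is_adjoint T S].

Definition seminormA A x : R := Num.sqrt (complex.Re (idot (A x) x)).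

(* The set is bounded above when T has a reduced solution; when A = 0 it is
   empty and its sup is 0. *)
Definition opnormA A T : R :=
  sup [set seminormA A (T x) | x in [set x | seminormA A x = 1]].

Definition bounded_opA A : set (H -> H) :=
  [set T | bounded_op T /\ range (adjoint T \o A) `<=` range A].

Definition is_reduced_solution A T X :=
  [/\ bounded_op X, A \o X = adjoint T \o A &
      range X `<=` closure (range A)].

(* For positive A and T in bounded_opA A there is exactly one reduced solution
   (Douglas); the default value 0 is only reached outside bounded_opA A. *)
Definition sharpA A T : H -> H := xget 0 [set X | is_reduced_solution A T X].

End Operators.

(* Main.v *)
Require Import Defs.
From mathcomp Require Import all_boot all_order all_algebra complex.
From mathcomp Require Import all_classical all_reals all_analysis.
From mathcomp Require Import ring lra.
Import Order.TTheory GRing.Theory Num.Theory.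
Import numFieldNormedType.Exports.
Local Open Scope classical_set_scope.
Local Open Scope complex_scope.
Local Open Scope ring_scope.

(** The seminorm inequality reduces to numbers.  Write [p x] for <Ax, x> and fix
    [x] with [p x = 1].  Put [T] for the sum of the [X_k], [S] for the sum of
    the [X_k^# X_k], [s = <A S x, x>], which is the sum of the [p (X_k x)], and
    [t = p (T x) = <A T^# T x, x>], with [T^#] the sum of the [X_k^#].  By
    convexity of [p], [t <= n s] ([semi_norm_sum]), so
    [s + ((n - 2) s + t) / 2 = (n s + t) / 2 >= t].
    Both [S] and [Q = (n - 2) S + T^# T] are selfadjoint for the form <Ax, y>,
    so [s] and [<A Q x, x>] are at most their operator seminorms, by
    Cauchy-Schwarz ([semi_selfadjoint_le_opnormA]).

    The last step needs the supremum defining the seminorm of [S] and [Q] to be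
    over a bounded set.  If [Q] is bounded and selfadjoint for <Ax, y>, then
    [p (Q x) ^ 2 <= p (Q^2 x)] when [p x = 1]; iterating, [p (Q x) ^ (2^k)] is
    at most a constant times [(|Q|^2) ^ (2^k)], whence [p (Q x) <= |Q|^2]
    ([semi_selfadjoint_bounded]).

    The operators [X_k^#] must first be shown to exist, which is Douglas'
    range inclusion theorem ([reduced_solution_exists]): the solution at [y] is
    the projection onto the closure of the range of [A] of any [w] with
    [A w = T^* A y].  Its boundedness follows from the uniform boundedness
    principle applied to the functionals [y |-> <X y, A v> = <y, A T v>] with
    [|A v| <= 1] ([weakly_bounded]).  Adjoints and projections both come from
    one variational statement ([subspace_riesz]): on a subspace [V], the
    functional [|v|^2 - 2 f v] has minimizing sequences, which are Cauchy by
    the parallelogram law.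

    Apart from complex linearity, all this concerns only real parts of inner
    products, so the argument uses the real inner product [rdot] and the
    real-valued norm [rnorm], for which ordinary real inequalities apply. *)

(** * The underlying real inner product *)

Section RealInnerProduct.
Set Implicit Arguments.
Unset Strict Implicit.
Context {R : realType} {H : hilbertType R}.
Implicit Types (x y z : H) (a : R).

Definition rdot x y : R := complex.Re (idot x y).

Definition rnorm x : R := complex.Re `|x|.

Lemma normE x : `|x| = (rnorm x)%:C.
Proof. by rewrite /rnorm RRe_real // normr_real. Qed.

Lemma rnorm_ge0 x : 0 <= rnorm x.
Proof. by rewrite -(@lecR R) -normE normr_ge0. Qed.

Lemma rdotDl x y z : rdot (x + y) z = rdot x z + rdot y z.
Proof. by rewrite /rdot linearDl raddfD. Qed.

Lemma idotC x y : idot x y = (idot y x)^*%C.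
Proof. by rewrite (hermC idot) expr0 mul1r. Qed.

Lemma rdotC x y : rdot x y = rdot y x.
Proof. by rewrite /rdot idotC; case: (idot y x). Qed.

Lemma rdotZl a x y : rdot (a%:C *: x) y = a * rdot x y.
Proof.
rewrite /rdot linearZl_LR /=; case: (idot x y) => u v /=.
by rewrite mul0r subr0.
Qed.

Lemma rdotxx x : rdot x x = rnorm x ^+ 2.
Proof. by rewrite /rdot idot_norm normE -rmorphXn. Qed.

Lemma rdotDr x y z : rdot x (y + z) = rdot x y + rdot x z.
Proof. by rewrite rdotC rdotDl !(rdotC x). Qed.

Lemma rdotZr a x y : rdot x (a%:C *: y) = a * rdot x y.
Proof. by rewrite rdotC rdotZl rdotC. Qed.

Lemma rdotNl x y : rdot (- x) y = - rdot x y.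
Proof. by rewrite /rdot linearNl raddfN. Qed.

Lemma rdotNr x y : rdot x (- y) = - rdot x y.
Proof. by rewrite rdotC rdotNl rdotC. Qed.

Lemma rdot0l x : rdot 0 x = 0.
Proof. by rewrite /rdot linear0l. Qed.

Lemma rdot0r x : rdot x 0 = 0.
Proof. by rewrite rdotC rdot0l. Qed.

(** Complex identities between inner products follow from real ones, because
    the imaginary part of <x, y> is the real part of <-ix, y>. *)
Lemma idotE x y : idot x y = (rdot x y +i* - rdot ('i%C *: x) y)%C.
Proof.
rewrite /rdot linearZl_LR /=; case: (idot x y) => u v /=.
by rewrite mul0r mul1r sub0r opprK.
Qed.

Lemma rdot_il x y : rdot ('i%C *: x) y = - rdot x ('i%C *: y).
Proof.
rewrite /rdot linearZl_LR linearZr_LR /=; case: (idot x y) => u v /=.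
by rewrite !(mul0r, mul1r, mulNr, mulN1r, sub0r, opprK, oppr0).
Qed.

Lemma rdot_ii x y : rdot ('i%C *: x) ('i%C *: y) = rdot x y.
Proof. by rewrite rdot_il scalerA -expr2 sqr_i scaleN1r rdotNr opprK. Qed.

Lemma rnorm_eq0 x : rnorm x = 0 -> x = 0.
Proof. by move=> x0; apply/eqP; rewrite -normr_eq0 normE x0. Qed.

Lemma ler_rnormD x y : rnorm (x + y) <= rnorm x + rnorm y.
Proof. by rewrite -lecR rmorphD /= -!normE ler_normD. Qed.

Lemma rnormN x : rnorm (- x) = rnorm x.
Proof. by rewrite /rnorm normrN. Qed.

Lemma rnormB x y : rnorm (x - y) = rnorm (y - x).
Proof. by rewrite /rnorm distrC. Qed.

Lemma rnormZ a x : rnorm (a%:C *: x) = `|a| * rnorm x.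
Proof.
apply: complexI; rewrite -normE normrZ normE rmorphM /=; congr (_ * _).
by rewrite normc_def /= expr0n addr0 sqrtr_sqr.
Qed.

Lemma bounded_opP (T : H -> H) : bounded_op T ->
  exists2 M : R, 0 <= M & forall x, rnorm (T x) <= M * rnorm x.
Proof.
move=> [_ [M hM]]; exists `|M| => // x.
rewrite (@le_trans _ _ (M * rnorm x)) ?ler_wpM2r ?rnorm_ge0 ?ler_norm //.
by rewrite -lecR rmorphM /= -!normE.
Qed.

Lemma linear_addZ (T : H -> H) : linear T ->
  [/\ forall x y, T (x + y) = T x + T y, forall c x, T (c *: x) = c *: T x,
      forall x y, T (x - y) = T x - T y & T 0 = 0].
Proof.
move=> lT; have T0 : T 0 = 0.
  have := lT (-1) 0 0; rewrite scaler0 addr0 scaleN1r => ->; rewrite addNr //.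
have TZ c x : T (c *: x) = c *: T x by have := lT c x 0; rewrite !addr0 T0 addr0.
have TD x y : T (x + y) = T x + T y by have := lT 1 x y; rewrite !scale1r.
by split=> // x y; rewrite TD -(scaleN1r y) TZ scaleN1r.
Qed.

(** The discriminant of a nonnegative quadratic polynomial. *)
Lemma discr_le (a b c : R) : 0 <= c ->
  (forall t : R, 0 <= a + t * b *+ 2 + t ^+ 2 * c) -> b ^+ 2 <= a * c.
Proof.
move=> c0 h; have [c00|cn0] := eqVneq c 0.
  have [->|bn0] := eqVneq b 0; first by rewrite c00 mulr0 expr0n.
  (* With c = 0 the polynomial is affine, and takes the value -1 here. *)
  have := h (- (a + 1) / (2 * b)); rewrite c00 mulr0 addr0.
  have -> : a + - (a + 1) / (2 * b) * b *+ 2 = -1 by field.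
  by rewrite lerNr oppr0 ler10.
have cp : 0 < c by rewrite lt_def cn0.
(* The minimum of the polynomial is at -b / c. *)
have := h (- b / c).
have -> : a + - b / c * b *+ 2 + (- b / c) ^+ 2 * c = (a * c - b ^+ 2) / c.
  by field.
by rewrite pmulr_lge0 ?invr_gt0 // subr_ge0.
Qed.

(** Polarization: the imaginary parts of <Az, z> vanish, and comparing
    [z = ix + y] with [ix] and [y] gives the real part of the symmetry. *)
Lemma positive_op_sym (A : H -> H) : positive_op A ->
  forall x y, rdot (A x) y = rdot x (A y).
Proof.
move=> [[lA _] pA] x y; have [AD AZ _ _] := linear_addZ lA.
have im0 z : rdot ('i%C *: A z) z = 0.
  have := pA z; rewrite idotE lecE /= => /andP[/eqP /eqP + _].
  by rewrite oppr_eq0 => /eqP.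
have sym0 u v : rdot ('i%C *: A u) v + rdot ('i%C *: A v) u = 0.
  have := im0 (u + v).
  by rewrite AD scalerDr !rdotDl !rdotDr !im0 add0r addr0.
have := sym0 ('i%C *: x) y.
rewrite AZ scalerA -expr2 sqr_i scaleN1r rdotNl rdot_ii (rdotC (A y)).
by rewrite addrC => /eqP; rewrite subr_eq0 => /eqP.
Qed.

End RealInnerProduct.

(** * Cauchy-Schwarz and completeness *)

Section Complete.
Set Implicit Arguments.
Unset Strict Implicit.
Context {R : realType} {H : hilbertType R}.
Implicit Types (x y z : H) (a : R).

Lemma positive_op_ge0 (A : H -> H) x : positive_op A -> 0 <= rdot (A x) x.
Proof. by move=> [_ /(_ x)]; rewrite lecE => /andP[]. Qed.

Lemma positive_op_CS (A : H -> H) x y : positive_op A ->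
  rdot (A x) y ^+ 2 <= rdot (A x) x * rdot (A y) y.
Proof.
move=> pA; have [[lA _] _] := pA; have [AD AZ _ _] := linear_addZ lA.
apply: discr_le => [|t]; first exact: positive_op_ge0.
have := positive_op_ge0 (x + t%:C *: y) pA.
rewrite AD AZ !rdotDl !rdotDr !rdotZl !rdotZr (rdotC (A y) x).
rewrite -(positive_op_sym pA x).
by congr (0 <= _); ring.
Qed.

Lemma positive_op_id : positive_op (@idfun H).
Proof.
split; last by move=> x; rewrite idot_norm exprn_ge0.
by split=> // ; exists 1 => x; rewrite mul1r.
Qed.

Lemma rdot_CS x y : `|rdot x y| <= rnorm x * rnorm y.
Proof.
rewrite -(@ler_pXn2r _ 2) ?nnegrE ?mulr_ge0 ?rnorm_ge0 //.
by rewrite exprMn -!rdotxx real_normK ?num_real // (positive_op_CS x y positive_op_id).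
Qed.

Lemma geometric_small (c q e : R) : 0 <= q < 1 -> 0 < e ->
  exists N, c * q ^+ N < e.
Proof.
move=> /andP[q0 q1] e0.
have /cvgrPdist_lt /(_ (e / (`|c| + 1))) : (fun n => q ^+ n) @ \oo --> (0 : R).
  by apply: cvg_expr; rewrite ger0_norm.
have c1 : 0 < `|c| + 1 by rewrite ltr_wpDl.
rewrite divr_gt0 // => /(_ isT)[N _ /(_ N (leqnn N))] /=.
rewrite sub0r normrN ltr_pdivlMr // ger0_norm ?exprn_ge0 // => hN.
exists N; apply: le_lt_trans hN; rewrite mulrC ler_wpM2l ?exprn_ge0 //.
by rewrite (le_trans (ler_norm c)) // lerDl.
Qed.

(** Completeness, with the rate inherited by the limit. *)
Lemma geometric_cvg (u : nat -> H) (c q : R) : 0 <= q < 1 ->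
  (forall n m, (n <= m)%N -> rnorm (u m - u n) <= c * q ^+ n) ->
  exists l, forall n, rnorm (u n - l) <= c * q ^+ n.
Proof.
move=> q01 hu.
have cu : cvg (u @ \oo).
  suff : cauchy_ex (u @ \oo) by move/cauchy_exP/cauchy_cvg.
  move=> e e0; rewrite /fmapE.
  have er : (complex.Re e)%:C = e by rewrite RRe_real // gtr0_real.
  have [|N hN] := @geometric_small c q (complex.Re e) q01.
    by rewrite -(@ltcR R) er.
  exists (u N), N => // m Nm.
  rewrite /= -ball_normE /ball_ /= normE rnormB -er ltcR.
  exact: le_lt_trans (hu _ _ Nm) hN.
have [l hl] : exists l : H, u @ \oo --> l by exists (lim (u @ \oo)).
exists l => n; apply/ler_addgt0Pr => e e0.
have e0c : 0 < e%:C :> R[i] by rewrite (@ltcR R 0).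
have /cvgrPdist_lt /(_ _ e0c)[N _ hN] := hl.
have := hN (maxn N n) (leq_maxl _ _); rewrite /= normE ltcR => /ltW h1.
have h2 := hu _ _ (leq_maxr N n).
have -> : u n - l = (u n - u (maxn N n)) + (u (maxn N n) - l) by rewrite addrA subrK.
apply: le_trans (ler_rnormD _ _) _; apply: lerD; by rewrite rnormB.
Qed.

End Complete.

(** * Riesz representation, projections and adjoints *)

Section Riesz.
Set Implicit Arguments.
Unset Strict Implicit.
Context {R : realType} {H : hilbertType R}.
Implicit Types (x y z : H) (a : R) (V : set H).

Lemma closure_rnormP V z :
  closure V z <-> forall e : R, 0 < e -> exists2 v, V v & rnorm (z - v) < e.
Proof.
split=> [cVz e e0|h B].
  have e0c : 0 < e%:C :> R[i] by rewrite (@ltcR R 0).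
  have [v [Vv]] := cVz _ (nbhsx_ballx z _ e0c).
  by rewrite -ball_normE /ball_ /= normE ltcR; exists v.
move=> /nbhs_ballP[e e0 zB].
have er : (complex.Re e)%:C = e by rewrite RRe_real // gtr0_real.
have [|v Vv hv] := h (complex.Re e); first by rewrite -(@ltcR R) er.
exists v; split=> //; apply: zB.
by rewrite -ball_normE /ball_ /= normE -er ltcR.
Qed.

Lemma geometric_eq0 (b c q : R) : 0 <= q < 1 ->
  (forall n, `|b| <= c * q ^+ n) -> b = 0.
Proof.
move=> q01 h; apply/eqP; apply: contraT; rewrite -normr_gt0 => b0.
have [N hN] := @geometric_small _ c q _ q01 b0.
by have := lt_le_trans hN (h N); rewrite ltxx.
Qed.

(** A minimizer of [J x = |x|^2 - 2 f x] over [V] represents [f] on [V].  The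
    infimum is finite because [J x >= (|x| - M)^2 - M^2].  The parallelogram
    law [J x + J y = 2 J ((x + y) / 2) + |x - y|^2 / 2] makes a minimizing
    sequence Cauchy, so that its limit lies in the closure of [V]; and the
    variation of [J] in direction [v] bounds [<u_n, v> - f v] through a
    discriminant.  With [V] everything this is the Riesz theorem, with [f] an
    inner product it is the projection onto the closure of [V]. *)
Lemma subspace_riesz V (f : H -> R) (M : R) :
  V 0 -> (forall x y, V x -> V y -> V (x + y)) ->
  (forall a x, V x -> V (a%:C *: x)) ->
  (forall x y, f (x + y) = f x + f y) -> (forall a x, f (a%:C *: x) = a * f x) ->
  (forall x, `|f x| <= M * rnorm x) ->
  exists2 z, closure V z & forall v, V v -> rdot z v = f v.
Proof.
move=> V0 VD VZ fD fZ fM.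
pose J x := rdot x x - 2 * f x.
pose E := [set J x | x in V].
have Elb : has_lbound E.
  exists (- M ^+ 2) => _ [x _ <-]; rewrite /J rdotxx.
  have := fM x; have := ler_norm (f x); have := sqr_ge0 (rnorm x - M); nra.
have Einf : has_inf E by split=> //; exists (J 0), 0.
pose q : R := 2^-1.
have q01 : 0 <= q < 1 by rewrite /q; lra.
have q0 n : 0 < (q ^+ n) ^+ 2 by rewrite !exprn_gt0 // /q; lra.
(* Excess (2^-n)^2 over the infimum yields distances of order 2^-n. *)
have /choice[u hu] n : exists x, V x /\ J x < inf E + (q ^+ n) ^+ 2.
  by have [_ [x Vx <-] hx] := inf_adherent (q0 n) Einf; exists x.
have Jinf x : V x -> inf E <= J x by move=> Vx; apply: ge_inf => //; exists x.
have uV n : V (u n) by have [] := hu n.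
have uJ n : J (u n) <= inf E + (q ^+ n) ^+ 2 by have [_ /ltW] := hu n.
have qdec n m : (n <= m)%N -> (q ^+ m) ^+ 2 <= (q ^+ n) ^+ 2.
  move=> nm; rewrite !ler_pXn2r ?nnegrE ?exprn_ge0 //; try by case/andP: q01.
  by apply: ler_wiXn2l => //; case/andP: q01 => // _ /ltW.
have [|z hz] := @geometric_cvg _ _ u 2 q q01.
  move=> n m nm.
  have VZD : V ((2^-1 : R)%:C *: (u m + u n)) by apply: VZ; apply: VD.
  rewrite -(@ler_pXn2r _ 2) ?nnegrE ?rnorm_ge0 //; last first.
    by rewrite mulr_ge0 // exprn_ge0 //; case/andP: q01.
  rewrite -rdotxx exprMn.
  have := Jinf _ VZD; have := uJ n; have := uJ m; have := qdec _ _ nm.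
  rewrite /J !(fD, fZ, rdotZl, rdotZr, rdotDl, rdotDr, rdotNl, rdotNr).
  rewrite (rdotC (u n) (u m)); lra.
exists z.
  apply/closure_rnormP => e e0; have [N hN] := @geometric_small _ 2 q e q01 e0.
  by exists (u N) => //; rewrite rnormB; apply: le_lt_trans (hz N) hN.
move=> v Vv; apply/eqP; rewrite -subr_eq0; apply/eqP.
apply: (@geometric_eq0 _ (3 * rnorm v) q q01) => n.
have h1 : `|rdot (u n) v - f v| <= rnorm v * q ^+ n.
  have qn0 : 0 <= q ^+ n by rewrite exprn_ge0 //; case/andP: q01.
  rewrite -(@ler_pXn2r _ 2) ?nnegrE ?mulr_ge0 ?rnorm_ge0 //.
  rewrite real_normK ?num_real // exprMn mulrC -rdotxx.
  apply: discr_le => [|t]; first by rewrite rdotxx sqr_ge0.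
  have := Jinf (u n + t%:C *: v) (VD _ _ (uV n) (VZ t _ Vv)); have := uJ n.
  rewrite /J !(fD, fZ, rdotZl, rdotZr, rdotDl, rdotDr) (rdotC v).
  by lra.
have -> : rdot z v - f v = rdot (u n) v - f v - rdot (u n - z) v.
  by rewrite rdotDl rdotNl; ring.
apply: le_trans (ler_normB _ _) _.
have := rdot_CS (u n - z) v; have := hz n; have := rnorm_ge0 v; move: h1.
nra.
Qed.

Lemma projection V w :
  V 0 -> (forall x y, V x -> V y -> V (x + y)) ->
  (forall a x, V x -> V (a%:C *: x)) ->
  exists2 z, closure V z & forall v, V v -> rdot z v = rdot w v.
Proof.
move=> V0 VD VZ; apply: (@subspace_riesz V (rdot w) (rnorm w)) => //.
- exact: rdotDr.
- by move=> a x; rewrite rdotZr.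
- exact: rdot_CS.
Qed.

Lemma rdot_inj x y : (forall z, rdot x z = rdot y z) -> x = y.
Proof.
move=> h; apply/eqP; rewrite -subr_eq0; apply/eqP/rnorm_eq0/eqP.
by rewrite -sqrf_eq0 -rdotxx rdotDl rdotNl h subrr.
Qed.

(** Riesz represents the real functionals [x |-> Re <T x, y>]; complex linearity
    of [T] upgrades this to the complex identity. *)
Lemma adjoint_exists (T : H -> H) : bounded_op T -> exists S, is_adjoint T S.
Proof.
move=> bT; have [M M0 hM] := bounded_opP bT.
have [TD TZ _ _] := linear_addZ bT.1.
have /choice[S hS] y : exists s, forall x, rdot s x = rdot (T x) y.
  have [|||x x'|a x|x|z _ hz] := @subspace_riesz setT
    (fun x => rdot (T x) y) (M * rnorm y) => //.
  - by rewrite TD rdotDl.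
  - by rewrite TZ rdotZl.
  - by rewrite (le_trans (rdot_CS _ _)) // mulrAC ler_wpM2r ?rnorm_ge0.
  - by exists z => x; apply: hz.
have hS2 x y : idot (T x) y = idot x (S y).
  by rewrite !idotE -TZ -!hS !(rdotC _ (S y)).
exists S; split=> //; split.
  move=> a x y.
  apply: rdot_inj => z; rewrite ![rdot _ z]rdotC /rdot -hS2 !linearDr !linearZr_LR /=.
  by rewrite !hS2.
exists M => x; rewrite !normE -rmorphM lecR.
have := hS x (S x); rewrite rdotxx => h.
have [->|s0] := eqVneq (rnorm (S x)) 0; first by rewrite mulr_ge0 ?rnorm_ge0.
have sp : 0 < rnorm (S x) by rewrite lt_def s0 rnorm_ge0.
rewrite -(ler_pM2r sp) -expr2 h (le_trans (ler_norm _)) //.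
by rewrite (le_trans (rdot_CS _ _)) // mulrAC ler_wpM2r ?rnorm_ge0.
Qed.

Lemma adjointP (T : H -> H) : bounded_op T -> is_adjoint T (adjoint T).
Proof. by move=> bT; apply: (xgetPex (0 : H -> H)); apply: adjoint_exists. Qed.

End Riesz.

(** * Uniform boundedness and Douglas' theorem *)

Section Douglas.
Set Implicit Arguments.
Unset Strict Implicit.
Context {R : realType} {H : hilbertType R}.
Implicit Types (x y z g : H) (a : R) (A T X : H -> H).

(** Since [2 <h, g> = <x + h, g> - <x - h, g>], one of the two translates of [x]
    by a vector [h] parallel to [g] has an inner product with [g] at least as
    large as that of [h]. *)
Lemma hump_step x g (t : R) : 0 <= t ->
  exists2 x', rnorm (x' - x) <= t & t * rnorm g <= `|rdot x' g|.
Proof.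
move=> t0; have [g0|g0] := eqVneq (rnorm g) 0.
  exists x; last by rewrite g0 mulr0.
  by rewrite subrr -(scale0r (0 : H)) (rnormZ 0) normr0 mul0r.
pose h : H := (t / rnorm g)%:C *: g.
have tg0 : 0 <= t / rnorm g by rewrite divr_ge0 // rnorm_ge0.
have nh : rnorm h = t by rewrite rnormZ ger0_norm // divfK.
have hg : rdot h g = t * rnorm g by rewrite rdotZl rdotxx; field.
have [le_h|lt_h] := lerP (t * rnorm g) `|rdot (x + h) g|.
  by exists (x + h) => //; rewrite addrC addKr nh.
exists (x - h); first by rewrite addrC addKr rnormN nh.
move: lt_h; rewrite !rdotDl rdotNl hg ltr_norml => /andP[_ hl].
by rewrite ler_normr; apply/orP; right; lra.
Qed.

(** The uniform boundedness principle, by a gliding hump.  If [G] is unbounded,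
    choose [g_n] in [G] with [|g_n| > n 3^n] and move successively by at most
    [3^-n] to vectors [u_(n+1)] with [|<u_(n+1), g_n>| >= 3^-n |g_n|].  Later
    moves amount to at most [3^-n / 2], hence spoil at most half of this, so the
    limit [l] satisfies [|<l, g_n>| > n / 2] for all [n]. *)
Lemma weakly_bounded (G : set H) :
  (forall y, exists M : R, forall g, G g -> `|rdot y g| <= M) ->
  exists M : R, forall g, G g -> rnorm g <= M.
Proof.
move=> wG; apply: contrapT => /forallNP nb.
pose q : R := 3^-1.
have q01 : 0 <= q < 1 by rewrite /q; lra.
have q0 n : 0 < q ^+ n by rewrite exprn_gt0 // /q; lra.
have /choice[g hg] n : exists g, G g /\ n%:R / q ^+ n < rnorm g.
  have /existsNP[g /not_implyP[Gg /negP]] := nb (n%:R / q ^+ n).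
  by rewrite -ltNge; exists g.
have /choice[f hf] (p : nat * H) : exists x', rnorm (x' - p.2) <= q ^+ p.1 /\
    q ^+ p.1 * rnorm (g p.1) <= `|rdot x' (g p.1)|.
  by have [x' ? ?] := hump_step p.2 (g p.1) (ltW (q0 p.1)); exists x'.
pose fix u n := if n is k.+1 then f (k, u k) else 0 : H.
have uS n : rnorm (u n.+1 - u n) <= q ^+ n by have [] := hf (n, u n).
have ug n : q ^+ n * rnorm (g n) <= `|rdot (u n.+1) (g n)|.
  by have [] := hf (n, u n).
have udist n k : rnorm (u (n + k)%N - u n) <= 3 / 2 * (q ^+ n - q ^+ (n + k)).
  elim: k => [|k IH].
    by rewrite addn0 !subrr mulr0 -(scale0r (0 : H)) (rnormZ 0) normr0 mul0r.
  have -> : u (n + k.+1)%N - u n = (u (n + k.+1)%N - u (n + k)%N) + (u (n + k)%N - u n).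
    by rewrite addrA subrK.
  apply: le_trans (ler_rnormD _ _) _; rewrite addnS.
  have := uS (n + k)%N; have := IH.
  by rewrite exprS /q; lra.
have [|l hl] := @geometric_cvg _ _ u (3 / 2) q q01.
  move=> n m /subnKC <-; apply: le_trans (udist _ _) _.
  by rewrite ler_wpM2l ?divr_ge0 // gerBl ltW.
have [M hM] := wG l.
have lb n : n%:R / 2 <= `|rdot l (g n)|.
  have [_ /ltW] := hg n; rewrite ler_pdivrMr // mulrC => hn.
  have -> : l = u n.+1 - (u n.+1 - l) by rewrite subKr.
  rewrite rdotDl rdotNl; apply: le_trans (lerB_dist _ _).
  have := rdot_CS (u n.+1 - l) (g n); have := ug n.
  have := ler_wpM2r (rnorm_ge0 (g n)) (hl n.+1).
  (* 3/2 is the sum of the series of 3^-k; shifted by one it becomes 1/2. *)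
  rewrite exprS (_ : 3 / 2 * (q * q ^+ n) = q ^+ n / 2); last by rewrite /q; field.
  move: (rdot _ _) (rdot _ _) => b b' h1 h2 h3.
  have := le_trans h3 h1; lra.
have [Gg _] := hg (Num.truncn (2 * M)).+1.
have := le_trans (lb _) (hM _ Gg).
have := truncnS_gt (2 * M); lra.
Qed.

(** The kernel of [A] is orthogonal to its range, by symmetry.  This gives
    uniqueness in the closure of the range, hence linearity, below. *)
Lemma closure_range_ker A z d : positive_op A -> A d = 0 ->
  closure (range A) z -> rdot z d = 0.
Proof.
move=> pA Ad /closure_rnormP cz.
apply/eqP; rewrite -normr_le0; apply/ler_addgt0Pr => e e0; rewrite add0r.
have d1 : 0 < rnorm d + 1 by rewrite ltr_wpDl // rnorm_ge0.
have [|_ [v _ <-] hv] := cz (e / (rnorm d + 1)); first by rewrite divr_gt0.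
have -> : rdot z d = rdot (z - A v) d.
  by rewrite rdotDl rdotNl (positive_op_sym pA) Ad rdot0r subr0.
apply: le_trans (rdot_CS _ _) _.
have := ltW hv; rewrite ler_pdivlMr //; have := rnorm_ge0 (z - A v); nra.
Qed.

(** Douglas' theorem for the equation [A X = T^* A]. *)
Lemma reduced_solution_exists A T : positive_op A -> bounded_opA A T ->
  exists X, is_reduced_solution A T X.
Proof.
move=> pA [bT rT]; have [bS hS] := adjointP bT; set S := adjoint T in bS hS rT.
have [AD AZ AB A0] := linear_addZ pA.1.1.
have [SD SZ SB S0] := linear_addZ bS.1.
have [TD TZ TB T0] := linear_addZ bT.1.
have Asym := positive_op_sym pA.
have hSr x y : rdot (T x) y = rdot x (S y) by rewrite /rdot hS.
have /choice[X hX] y : exists z, closure (range A) z /\ A z = S (A y).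
  have [|w _ Aw] := rT (S (A y)); first by exists y.
  have [|||z cz zw] := @projection _ _ (range A) w.
  - by exists 0.
  - by move=> _ _ [u _ <-] [v _ <-]; exists (u + v).
  - by move=> a _ [u _ <-]; exists (a%:C *: u).
  (* w - z is orthogonal to the range of A, so it lies in the kernel of A. *)
  exists z; split=> //; rewrite -Aw; apply: rdot_inj => v.
  by rewrite !Asym; apply: zw; exists v.
have XA y v : rdot (X y) (A v) = rdot y (A (T v)).
  by rewrite -Asym (hX y).2 rdotC -hSr rdotC Asym.
exists X; split; first split.
- move=> a x y; pose d := X (a *: x + y) - (a *: X x + X y).
  suff : d = 0 by move/eqP; rewrite subr_eq0 => /eqP.
  have Ad : A d = 0.
    rewrite AB AD AZ (hX _).2 (hX x).2 (hX y).2 AD AZ SD SZ subrr //.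
  have od z : rdot (X z) d = 0 by apply: closure_range_ker pA Ad (hX z).1.
  have oda : rdot (a *: X x) d = 0.
    have -> : rdot (a *: X x) d = rdot (X x) (a^*%C *: d).
      by rewrite /rdot linearZl_LR linearZr_LR /= [Num.conj _]conjcK.
    by apply: closure_range_ker pA _ (hX x).1; rewrite AZ Ad scaler0.
  apply: rnorm_eq0; apply/eqP; rewrite -sqrf_eq0 -rdotxx {1}/d.
  by rewrite rdotDl rdotNl rdotDl !od oda addr0 subr0.
- (* |X y|^2 is the limit of <X y, A v> = <y, A T v> as A v tends to X y, and
     |A T v| <= M |A v|. *)
  pose G := [set S' | exists2 v, rnorm (A v) <= 1 & S' = A (T v)].
  have [|M hM] := @weakly_bounded G.
    move=> y; exists (rnorm (X y)) => _ [v Av ->].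
    rewrite -XA.
    by rewrite (le_trans (rdot_CS _ _)) // ler_piMr ?rnorm_ge0.
  have M0 : 0 <= M.
    apply: le_trans (rnorm_ge0 _) (hM (A (T 0)) _).
    by exists 0 => //; rewrite A0 -(scale0r (0 : H)) (rnormZ 0) normr0 mul0r.
  exists M => y; rewrite !normE -rmorphM lecR.
  have key (v : H) (s : R) : 0 < s -> rnorm (A v) <= s ->
      rdot (X y) (A v) <= s * (M * rnorm y).
    move=> s0 Avs.
    have -> : v = s%:C *: (s^-1%:C *: v).
      by rewrite scalerA -rmorphM mulfV ?gt_eqF // scale1r.
    set w := _ *: v.
    rewrite AZ rdotZr ler_pM2l // XA.
    rewrite (le_trans (ler_norm _)) // (le_trans (rdot_CS _ _)) // mulrC.
    rewrite ler_wpM2r ?rnorm_ge0 //; apply: hM; exists w => //.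
    by rewrite AZ rnormZ gtr0_norm ?invr_gt0 // ler_pdivrMl // mulr1.
  have [-> |X0] := eqVneq (rnorm (X y)) 0; first by rewrite mulr_ge0 ?rnorm_ge0.
  have Xp : 0 < rnorm (X y) by rewrite lt_def X0 rnorm_ge0.
  have m0 : 0 <= M * rnorm y by rewrite mulr_ge0 ?rnorm_ge0.
  rewrite -(ler_pM2r Xp) -expr2 -rdotxx; apply/ler_addgt0Pr => e e0.
  pose c := rnorm (X y) + M * rnorm y.
  have c0 : 0 < c by rewrite ltr_pwDl.
  have ec : 0 < e / c by rewrite divr_gt0.
  have [_ [v _ <-] hv] := (closure_rnormP _ _).1 (hX y).1 _ ec.
  have Av : rnorm (A v) <= rnorm (X y) + e / c.
    rewrite -[A v](subrK (X y)) (le_trans (ler_rnormD _ _)) // addrC lerD2l.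
    by rewrite rnormB ltW.
  (* With e' = e / c, the bound is
     |Xy| e' + (|Xy| + e') M |y| = e + |Xy| M |y|. *)
  have := key v _ (addr_gt0 Xp ec) Av.
  have -> : rdot (X y) (X y) = rdot (X y) (X y - A v) + rdot (X y) (A v).
    by rewrite -rdotDr subrK.
  have := le_trans (ler_norm _) (rdot_CS (X y) (X y - A v)).
  have := ler_wpM2l (rnorm_ge0 (X y)) (ltW hv).
  have : e / c * c = e by rewrite divfK // gt_eqF.
  rewrite {2}/c; move: (e / c) => e'; lra.
- by apply/funext => y /=; rewrite (hX y).2.
- by move=> _ [y _ <-]; exact: (hX y).1.
Qed.

Lemma sharpAP A T : positive_op A -> bounded_opA A T ->
  is_reduced_solution A T (sharpA A T).
Proof.
by move=> pA bT; apply: (xgetPex (0 : H -> H)); apply: reduced_solution_exists.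
Qed.

End Douglas.

(** * Adjoints for the form of a positive operator *)

Section SemiInnerProduct.
Set Implicit Arguments.
Unset Strict Implicit.
Context {R : realType} {H : hilbertType R}.
Implicit Types (x y z : H) (a : R) (A T S Q : H -> H).

Definition semi_adjoint A T S := forall x y, rdot (A (T x)) y = rdot (A x) (S y).

Lemma seminormAE A x : seminormA A x = Num.sqrt (rdot (A x) x).
Proof. by []. Qed.

(** This holds whatever the set, since a set of reals without supremum is given
    the supremum 0. *)
Lemma opnormA_ge0 A T : 0 <= opnormA A T.
Proof.
have [hs|/sup_out E] := pselect (has_sup [set seminormA A (T x) | x in
  [set x | seminormA A x = 1]]); last by rewrite /opnormA E.
have [[_ [x xA _]] ub] := hs.
by apply: le_trans (sqrtr_ge0 _) (ub_le_sup ub _); exists x.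
Qed.

Lemma opnormA_le A T (M : R) : 0 <= M ->
  (forall x, seminormA A x = 1 -> seminormA A (T x) <= M) -> opnormA A T <= M.
Proof.
move=> M0 hM; rewrite /opnormA.
have [->|/set0P E0] := eqVneq [set seminormA A (T x) | x in
  [set x | seminormA A x = 1]] set0; first by rewrite sup0.
by apply: ge_sup => // _ [x xA <-]; exact: hM.
Qed.

Lemma semi_adjoint_sym A T S : positive_op A ->
  semi_adjoint A T S -> semi_adjoint A S T.
Proof.
move=> pA h x y; have As := positive_op_sym pA.
by rewrite As rdotC -h As rdotC.
Qed.

Lemma semi_adjoint_comp A T S T' S' :
  semi_adjoint A T S -> semi_adjoint A T' S' ->
  semi_adjoint A (T \o T') (S' \o S).
Proof. by move=> h h' x y; rewrite /= h h'. Qed.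

Lemma semi_adjoint_add A T S T' S' : linear A ->
  semi_adjoint A T S -> semi_adjoint A T' S' ->
  semi_adjoint A (T + T') (S + S').
Proof.
move=> /linear_addZ[AD _ _ _] h h' x y.
by rewrite !fctE AD rdotDl rdotDr h h'.
Qed.

Lemma semi_adjoint_sum A n (T S : 'I_n -> H -> H) : linear A ->
  (forall k, semi_adjoint A (T k) (S k)) ->
  semi_adjoint A (\sum_k T k) (\sum_k S k).
Proof.
move=> lA h; apply: (big_ind2 (semi_adjoint A)) => //.
- move=> x y; have [_ _ _ A0] := linear_addZ lA.
  by rewrite /= A0 rdot0l rdot0r.
- by move=> *; apply: semi_adjoint_add.
Qed.

Lemma semi_adjoint_scale A T S a : linear A ->
  semi_adjoint A T S -> semi_adjoint A (a%:C *: T) (a%:C *: S).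
Proof.
move=> /linear_addZ[_ AZ _ _] h x y.
by rewrite !fctE AZ rdotZl rdotZr h.
Qed.

Lemma bounded_op_add T S : bounded_op T -> bounded_op S -> bounded_op (T + S).
Proof.
move=> bT bS; have [[lT _] [lS _]] := (bT, bS); split.
  by move=> a x y; rewrite !fctE lT lS scalerDr addrACA.
have [M _ hM] := bounded_opP bT; have [N _ hN] := bounded_opP bS.
exists (M + N) => x; rewrite !normE -rmorphM lecR fctE mulrDl.
by rewrite (le_trans (ler_rnormD _ _)) // lerD.
Qed.

Lemma bounded_op_scale T a : bounded_op T -> bounded_op (a%:C *: T).
Proof.
move=> bT; have [lT _] := bT; split.
  by move=> b x y; rewrite !fctE lT scalerDr !scalerA mulrC.
have [M _ hM] := bounded_opP bT.
exists (`|a| * M) => x; rewrite !normE -rmorphM lecR fctE rnormZ -mulrA.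
by rewrite ler_wpM2l.
Qed.

Lemma bounded_op_comp T S : bounded_op T -> bounded_op S -> bounded_op (T \o S).
Proof.
move=> bT bS; have [[lT _] [lS _]] := (bT, bS); split.
  by move=> a x y; rewrite /= lS lT.
have [M M0 hM] := bounded_opP bT; have [N _ hN] := bounded_opP bS.
exists (M * N) => x; rewrite !normE -rmorphM lecR /=.
by rewrite (le_trans (hM _)) // -mulrA ler_wpM2l.
Qed.

Lemma bounded_op0 : bounded_op (0 : H -> H).
Proof.
split; first by move=> a x y; rewrite /= scaler0 addr0.
by exists 0 => x; rewrite /= normr0 mul0r.
Qed.

Lemma bounded_op_sum n (T : 'I_n -> H -> H) :
  (forall k, bounded_op (T k)) -> bounded_op (\sum_k T k).
Proof.
move=> h; apply: (big_ind bounded_op) => //; first exact: bounded_op0.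
by move=> *; apply: bounded_op_add.
Qed.

(** For [p z = <Az, z>] and [p x = 1], Cauchy-Schwarz and selfadjointness give
    [p (Q^n x) ^ 2 = <A Q^(2n) x, x> ^ 2 <= p (Q^(2n) x)].  Iterating,
    [p (Q x) ^ (2^k) <= p (Q^(2^k) x) <= K (M^2) ^ (2^k)] where [M] bounds [Q]
    and [K] depends on [x]; if [p (Q x)] were larger than [M^2], the quotient of
    the two sides would tend to infinity with [k]. *)
Lemma semi_selfadjoint_bounded A Q : positive_op A -> bounded_op Q ->
  semi_adjoint A Q Q ->
  exists C : R, forall x, rdot (A x) x = 1 -> rdot (A (Q x)) (Q x) <= C.
Proof.
move=> pA bQ sQ; have [M M0 hM] := bounded_opP bQ.
have [MA MA0 hA] := bounded_opP pA.1.
exists (M ^+ 2) => x px; pose p z := rdot (A z) z; rewrite -[leLHS]/(p (Q x)).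
have siter n : semi_adjoint A (iter n Q) (iter n Q).
  by elim: n => // n IH u v; rewrite iterSr IH /= sQ -iterS.
have p_sqr n : p (iter n Q x) ^+ 2 <= p (iter (n + n) Q x).
  rewrite /p -siter -iterD -[leRHS]mulr1 -[X in _ * X]px.
  exact: positive_op_CS.
have p_pow k : p (Q x) ^+ (2 ^ k) <= p (iter (2 ^ k) Q x).
  elim: k => [|k IH]; first by rewrite expr1.
  rewrite expnS mul2n -addnn (le_trans _ (p_sqr _)) // exprD -expr2.
  by rewrite ler_pXn2r // nnegrE ?exprn_ge0 // positive_op_ge0.
have upper n : p (iter n Q x) <= MA * rnorm x ^+ 2 * (M ^+ 2) ^+ n.
  have hn : rnorm (iter n Q x) <= M ^+ n * rnorm x.
    elim: n => [|n IH]; first by rewrite mul1r.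
    by rewrite /= (le_trans (hM _)) // exprS -mulrA ler_wpM2l.
  apply: le_trans (le_trans (ler_norm _) (rdot_CS _ _)) _.
  have h1 := ler_wpM2r (rnorm_ge0 (iter n Q x)) (hA (iter n Q x)).
  apply: le_trans h1 _.
  have -> : MA * rnorm x ^+ 2 * (M ^+ 2) ^+ n = MA * (M ^+ n * rnorm x) ^+ 2.
    by rewrite exprMn; ring.
  rewrite -mulrA ler_wpM2l // -[leLHS]expr2.
  by rewrite ler_pXn2r ?nnegrE ?mulr_ge0 ?exprn_ge0 ?rnorm_ge0.
have [//|ltb] := lerP (p (Q x)) (M ^+ 2).
have b0 : 0 < p (Q x) by rewrite (le_lt_trans _ ltb) // exprn_ge0.
pose r := M ^+ 2 / p (Q x).
have r0 : 0 <= r by rewrite divr_ge0 ?exprn_ge0 // ltW.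
have r1 : r < 1 by rewrite ltr_pdivrMr // mul1r.
have [|N] := @geometric_small _ (MA * rnorm x ^+ 2) r 1 _ ltr01; first by rewrite r0.
rewrite ltNge => /negP[]; apply: (@le_trans _ _ (MA * rnorm x ^+ 2 * r ^+ (2 ^ N))).
  by rewrite expr_div_n mulrA ler_pdivlMr ?exprn_gt0 // mul1r (le_trans (p_pow _)).
rewrite ler_wpM2l ?mulr_ge0 ?exprn_ge0 ?rnorm_ge0 //.
by rewrite ler_wiXn2l ?(ltW r1) // ltnW // ltn_expl.
Qed.

(** Cauchy-Schwarz gives [<A Q x, x> <= |Q x|_A]; the supremum bounds the right
    side because selfadjointness makes it finite. *)
Lemma semi_selfadjoint_le_opnormA A Q x : positive_op A -> bounded_op Q ->
  semi_adjoint A Q Q -> rdot (A x) x = 1 -> rdot (A (Q x)) x <= opnormA A Q.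
Proof.
move=> pA bQ sQ px; have [C hC] := semi_selfadjoint_bounded pA bQ sQ.
have sqrt1 y : seminormA A y = 1 -> rdot (A y) y = 1.
  move=> h; rewrite -(sqr_sqrtr (positive_op_ge0 y pA)).
  by rewrite -seminormAE h expr1n.
apply: (@le_trans _ _ (seminormA A (Q x))).
  rewrite (le_trans (ler_norm _)) // -sqrtr_sqr seminormAE ler_wsqrtr //.
  by rewrite -[leRHS]mulr1 -px positive_op_CS.
apply: ub_le_sup; last by exists x => //=; rewrite seminormAE px sqrtr1.
exists (Num.sqrt C) => _ [y /sqrt1 py <-].
by rewrite seminormAE ler_wsqrtr // hC.
Qed.

(** Expand the square and use [2 <A x_j, x_k> <= p x_j + p x_k], which is
    [p (x_j - x_k) >= 0]. *)
Lemma semi_norm_sum A n (x : 'I_n -> H) : positive_op A ->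
  rdot (A (\sum_k x k)) (\sum_k x k) <= n%:R * \sum_k rdot (A (x k)) (x k).
Proof.
move=> pA; have lA := pA.1.1; have [AD AZ AB A0] := linear_addZ lA.
have sl (I : 'I_n -> H) y : rdot (A (\sum_k I k)) y = \sum_k rdot (A (I k)) y.
  apply: (big_morph (fun z => rdot (A z) y)); last by rewrite A0 rdot0l.
  by move=> u v; rewrite AD rdotDl.
have sr (I : 'I_n -> H) y : rdot y (\sum_k I k) = \sum_k rdot y (I k).
  by apply: (big_morph (rdot y)); [exact: rdotDr|exact: rdot0r].
pose p k := rdot (A (x k)) (x k).
rewrite sl; under eq_bigr do rewrite sr.
apply: (@le_trans _ _ (\sum_(j < n) \sum_(k < n) ((p j + p k) / 2))).
  apply: ler_sum => j _; apply: ler_sum => k _.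
  have := positive_op_ge0 (x j - x k) pA.
  rewrite AB !(rdotDl, rdotDr, rdotNl, rdotNr) (rdotC (A (x k)) (x j)).
  by rewrite -(positive_op_sym pA (x j)) /p; lra.
under eq_bigr do rewrite -mulr_suml big_split /= sumr_const card_ord.
rewrite -mulr_suml big_split /= sumr_const card_ord -sumrMnl.
rewrite -mulr_natl mulr_sumr.
under eq_bigr do rewrite -mulr_natl.
rewrite -mulr_sumr /p; lra.
Qed.

End SemiInnerProduct.

(** * The inequality *)

Theorem theorem2p1 (R : realType) (H : hilbertType R) (A : H -> H)
    (hA : positive_op A) (n : nat) (hn : (1 <= n)%N)
    (X : 'I_n -> (H -> H)) (hX : forall k, bounded_opA A (X k)) :
  opnormA A (\sum_(k < n) X k) ^+ 2 <=
    opnormA A (\sum_(k < n) (sharpA A (X k) \o X k)) +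
    2^-1 * opnormA A
      ((n%:R - 2 : R[i]) *: (\sum_(k < n) (sharpA A (X k) \o X k)) +
       ((\sum_(k < n) sharpA A (X k)) \o (\sum_(k < n) X k))).
Proof.
have lA := hA.1.1.
have bX k : bounded_op (X k) := (hX k).1.
have adjX k : semi_adjoint A (sharpA A (X k)) (X k).
  have [_ AXe _] := sharpAP hA (hX k).
  move=> x y; have [_ hS] := adjointP (bX k).
  have -> : A (sharpA A (X k) x) = adjoint (X k) (A x).
    by rewrite -[LHS]/((A \o _) x) AXe.
  by rewrite rdotC /rdot -hS -/(rdot _ _) rdotC.
have bXs k : bounded_op (sharpA A (X k)) by have [] := sharpAP hA (hX k).
have adjX' k := semi_adjoint_sym hA (adjX k).
set T := \sum_(k < n) X k; set T' := \sum_(k < n) sharpA A (X k).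
set S := \sum_(k < n) (sharpA A (X k) \o X k).
have adjT : semi_adjoint A T' T by exact: semi_adjoint_sum.
have adjT' := semi_adjoint_sym hA adjT.
have adjS : semi_adjoint A S S.
  by apply: semi_adjoint_sum => // k; exact: semi_adjoint_comp.
have bS : bounded_op S by apply: bounded_op_sum => k; exact: bounded_op_comp.
have -> : (n%:R - 2 : R[i]) = (n%:R - 2 : R)%:C by rewrite rmorphB /= !rmorph_nat.
set Q := _ *: S + _.
have adjQ : semi_adjoint A Q Q.
  apply: semi_adjoint_add => //; first exact: semi_adjoint_scale.
  exact: semi_adjoint_comp.
have bQ : bounded_op Q.
  apply: bounded_op_add; first exact: bounded_op_scale.
  by apply: bounded_op_comp; exact: bounded_op_sum.
set B := opnormA A S + 2^-1 * opnormA A Q.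
have B0 : 0 <= B by rewrite addr_ge0 ?mulr_ge0 ?opnormA_ge0 // invr_ge0.
have main x : seminormA A x = 1 -> seminormA A (T x) <= Num.sqrt B.
  move=> h; have {h} px : rdot (A x) x = 1.
    by rewrite -(sqr_sqrtr (positive_op_ge0 x hA)) -seminormAE h expr1n.
  rewrite seminormAE ler_wsqrtr //.
  have hS := semi_selfadjoint_le_opnormA hA bS adjS px.
  have hQ := semi_selfadjoint_le_opnormA hA bQ adjQ px.
  have Sx : rdot (A (S x)) x = \sum_k rdot (A (X k x)) (X k x).
    rewrite /S fct_sumE.
    rewrite (big_morph (fun z => rdot (A z) x) (id1 := 0) (op1 := +%R)).
    + by apply: eq_bigr => k _; rewrite /= adjX.
    + by have [AD _ _ _] := linear_addZ lA => u v; rewrite AD rdotDl.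
    + by have [_ _ _ A0] := linear_addZ lA; rewrite A0 rdot0l.
  have Qx : rdot (A (Q x)) x = (n%:R - 2) * rdot (A (S x)) x + rdot (A (T x)) (T x).
    have [AD AZ _ _] := linear_addZ lA.
    by rewrite /Q !fctE AD AZ rdotDl rdotZl /= adjT.
  have : rdot (A (T x)) (T x) <= n%:R * rdot (A (S x)) x.
    by rewrite Sx /T fct_sumE; exact: semi_norm_sum.
  (* With t <= n s the two bounds add up to (n s + t) / 2 >= t. *)
  by move: hQ; rewrite Qx /B; lra.
rewrite -[leRHS](sqr_sqrtr B0) ler_pXn2r ?nnegrE ?opnormA_ge0 ?sqrtr_ge0 //.
by apply: opnormA_le => //; exact: sqrtr_ge0.
Qed.
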